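(* Let $(T,[\cdot,\cdot,\cdot],(\cdot)^{[p]})$ be a restricted Lie triple system over a field of characteristic $p>2$ with a restricted Rota-Baxter operator $P$. Then $$\{x,y,z\}=[x,Py,Pz]\quad\text{and}\quad x^{[p]'}=(x,Px,\ldots,Px)$$ (with $Px$ occurring $p-1$ times) define on $T$ a structure of restricted pre-Lie triple system. Moreover, $P$ is a morphism of restricted Lie triple systems $P:(T,[\cdot,\cdot,\cdot]_C,(\cdot)^{[p]'})\to(T,[\cdot,\cdot,\cdot],(\cdot)^{[p]})$.
   Context: Lie triple system: a vector space $T$ with a trilinear bracket satisfying $[x,y,z]=-[y,x,z]$, $[x,y,z]+[y,z,x]+[z,x,y]=0$ and $[u,v,[x,y,z]]=[[u,v,x],y,z]+[x,[u,v,y],z]+[x,y,[u,v,z]]$. For odd $n\ge3$: $(x_1,\dots,x_n)=[[\cdots[[x_1,x_2,x_3],x_4,x_5],\cdots],x_{n-1},x_n]$. In characteristic $p>2$, $s_i(x,y)$ ($1\le i\le p-1$) is defined by: $i\,s_i(x,y)$ is the coefficient of $Z^{i-1}$ in $(x,Zx+y,\dots,Zx+y)$ ($Zx+y$ occurring $p-1$ times). Restricted Lie triple system: a Lie triple system over a field of characteristic $p>2$ with a map $(\cdot)^{[p]}:T\to T$ such that $(\alpha x)^{[p]}=\alpha^px^{[p]}$, $(x+y)^{[p]}=x^{[p]}+y^{[p]}+\sum_{i=1}^{p-1}s_i(x,y)$ and $[x,y^{[p]},z]=(x,y,\dots,y,z)$ ($p$ copies of $y$). A morphism of restricted Lie triple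 systems is a linear map preserving the ternary brackets and the $p$-maps. A Rota-Baxter operator of weight $0$ on $T$ is a linear map $P:T\to T$ with $[Px,Py,Pz]=P([x,Py,Pz]+[Px,y,Pz]+[Px,Py,z])$. It is restricted if $P(x)^{[p]}=P((x,Px,\dots,Px))$ ($Px$ occurring $p-1$ times inside the parentheses) for all $x\in T$. Pre-Lie triple system: a vector space $A$ with a trilinear map $\{\cdot,\cdot,\cdot\}$ such that, with $\{x,y,z\}^{\wedge}=\{z,y,x\}-\{z,x,y\}$ and $[x,y,z]_C=\{x,y,z\}-\{y,x,z\}+\{z,y,x\}-\{z,x,y\}$, for all $x_1,\dots,x_5\in A$: (1) $\{x_5,x_1,[x_2,x_3,x_4]_C\}=\{\{x_5,x_1,x_2\},x_3,x_4\}-\{\{x_5,x_1,x_3\},x_2,x_4\}+\{x_2,x_3,\{x_5,x_1,x_4\}\}^{\wedge}$; (2) $\{x_1,x_2,\{x_5,x_3,x_4\}\}^{\wedge}=\{\{x_1,x_2,x_5\}^{\wedge},x_3,x_4\}+\{x_5,[x_1,x_2,x_3]_C,x_4\}+\{x_5,x_3,[x_1,x_2,x_4]_C\}$. Then $(A,[\cdot,\cdot,\cdot]_C)$ is a Lie triple system (known). Put $\theta(x,y)(z)=\{z,x,y\}$. Restricted pre-Lie triple system (characteristic $p>2$): a pre-Lie triple system $T$ with a map $(\cdot)^{[p]}:T\to T$ such that for all scalars $\alpha$ and $x,y,z\in T$: (i) $(\alpha x)^{[p]}=\alpha^px^{[p]}$; (ii) $\{x,y^{[p]},z\}=\{\theta(y,y)^{\frac{p-1}{2}}(x),y,z\}$;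 (iii) $\{x,y,z^{[p]}\}=\theta(z,z)^{\frac{p-1}{2}}(\{x,y,z\})$; (iv) $[x,y^{[p]},z]_C=(x,y,\dots,y,z)_C$ ($p$ copies of $y$); (v) $(x+y)^{[p]}=x^{[p]}+y^{[p]}+\sum_{i=1}^{p-1}s_i(x,y)$, where $(\cdot,\dots,\cdot)_C$ and $s_i$ are computed in $(T,[\cdot,\cdot,\cdot]_C)$. Then $(T,[\cdot,\cdot,\cdot]_C)$ is a restricted Lie triple system with the same $p$-map. *)

(* Defs.v *)
From HB Require Import structures.
From mathcomp Require Import all_boot all_order all_algebra.

Set Implicit Arguments.
Unset Strict Implicit.
Unset Printing Implicit Defensive.

Import GRing.Theory.
Local Open Scope ring_scope.

(* [nbracket br x [:: a; b; c; d; ...]] is [... [[x, a, b], c, d] ...], i.e.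
   the n-fold bracket (x, a, b, c, d, ...).  The number n of arguments is odd,
   so the list must have even length: an unpaired last entry is ignored. *)
Fixpoint nbracket (T : Type) (br : T -> T -> T -> T) (x : T) (s : seq T) : T :=
  if s is a :: b :: s' then nbracket br (br x a b) s' else x.

Definition is_trilinear (F : fieldType) (T : lmodType F)
    (br : T -> T -> T -> T) : Prop :=
  [/\ forall y z, linear (fun x => br x y z),
      forall x z, linear (fun y => br x y z)
    & forall x y, linear (fun z => br x y z)].

Record is_lie_triple_system (F : fieldType) (T : lmodType F)
    (br : T -> T -> T -> T) : Prop := IsLieTripleSystem {
  lts_trilinear : is_trilinear br;
  lts_antisym : forall x y z, br x y z = - br y x z;
  lts_cyclic : forall x y z, br x y z + br y z x + br z x y = 0;
  lts_deriv : forall u v x y z,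
    br u v (br x y z) = br (br u v x) y z + br x (br u v y) z
                        + br x y (br u v z)
}.

(* A polynomial in Z with coefficients in T is represented by its sequence of
   coefficients [nat -> T].  [poly_bracket] is the F[Z]-trilinear extension of
   a trilinear bracket. *)
Definition poly_bracket (F : fieldType) (T : lmodType F)
    (br : T -> T -> T -> T) (f g h : nat -> T) : nat -> T :=
  fun k => \sum_(a < k.+1) \sum_(b < k.+1) \sum_(c < k.+1 | (a + b + c == k)%N)
             br (f a) (g b) (h c).

Definition poly_const (F : fieldType) (T : lmodType F) (x : T) : nat -> T :=
  fun k => if k is 0%N then x else 0.

(* The polynomial Z x + y. *)
Definition poly_Zxy (F : fieldType) (T : lmodType F) (x y : T) : nat -> T :=
  fun k => match k with 0%N => y | 1%N => x | _ => 0 end.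

(* Meaningful for 1 <= i <= p - 1, when i is invertible in F. *)
Definition s_coef (F : fieldType) (T : lmodType F) (p : nat)
    (br : T -> T -> T -> T) (i : nat) (x y : T) : T :=
  (i%:R : F)^-1 *: nbracket (poly_bracket br) (poly_const x)
                            (nseq p.-1 (poly_Zxy x y)) i.-1.

Record is_restricted_lts (F : fieldType) (T : lmodType F) (p : nat)
    (br : T -> T -> T -> T) (pm : T -> T) : Prop := IsRestrictedLts {
  rlts_lts : is_lie_triple_system br;
  rlts_scale : forall (a : F) x, pm (a *: x) = a ^+ p *: pm x;
  rlts_add : forall x y,
    pm (x + y) = pm x + pm y + \sum_(1 <= i < p) s_coef p br i x y;
  rlts_bracket : forall x y z,
    br x (pm y) z = nbracket br x (rcons (nseq p y) z)
}.

Record is_restricted_lts_morphism (F : fieldType) (T T' : lmodType F) (p : nat)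
    (br : T -> T -> T -> T) (pm : T -> T)
    (br' : T' -> T' -> T' -> T') (pm' : T' -> T')
    (f : {linear T -> T'}) : Prop := IsRestrictedLtsMorphism {
  rlts_morph_dom : is_restricted_lts p br pm;
  rlts_morph_cod : is_restricted_lts p br' pm';
  rlts_morph_bracket : forall x y z, f (br x y z) = br' (f x) (f y) (f z);
  rlts_morph_pmap : forall x, f (pm x) = pm' (f x)
}.

Definition is_rota_baxter (F : fieldType) (T : lmodType F)
    (br : T -> T -> T -> T) (P : {linear T -> T}) : Prop :=
  forall x y z, br (P x) (P y) (P z) =
    P (br x (P y) (P z) + br (P x) y (P z) + br (P x) (P y) z).

Record is_restricted_rota_baxter (F : fieldType) (T : lmodType F) (p : nat)
    (br : T -> T -> T -> T) (pm : T -> T) (P : {linear T -> T}) : Prop :=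
  IsRestrictedRotaBaxter {
  rrb_rota_baxter : is_rota_baxter br P;
  rrb_pmap : forall x, pm (P x) = P (nbracket br x (nseq p.-1 (P x)))
}.

(* {x, y, z}^ *)
Definition prelie_wedge (F : fieldType) (T : lmodType F)
    (tp : T -> T -> T -> T) (x y z : T) : T := tp z y x - tp z x y.

(* [x, y, z]_C *)
Definition prelie_comm (F : fieldType) (T : lmodType F)
    (tp : T -> T -> T -> T) (x y z : T) : T :=
  tp x y z - tp y x z + tp z y x - tp z x y.

Definition prelie_theta (F : fieldType) (T : lmodType F)
    (tp : T -> T -> T -> T) (x y z : T) : T := tp z x y.

Record is_prelie_triple_system (F : fieldType) (T : lmodType F)
    (tp : T -> T -> T -> T) : Prop := IsPrelieTripleSystem {
  plts_trilinear : is_trilinear tp;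
  plts_ax1 : forall x1 x2 x3 x4 x5,
    tp x5 x1 (prelie_comm tp x2 x3 x4) =
      tp (tp x5 x1 x2) x3 x4 - tp (tp x5 x1 x3) x2 x4
      + prelie_wedge tp x2 x3 (tp x5 x1 x4);
  plts_ax2 : forall x1 x2 x3 x4 x5,
    prelie_wedge tp x1 x2 (tp x5 x3 x4) =
      tp (prelie_wedge tp x1 x2 x5) x3 x4
      + tp x5 (prelie_comm tp x1 x2 x3) x4
      + tp x5 x3 (prelie_comm tp x1 x2 x4)
}.

Record is_restricted_prelie_triple_system (F : fieldType) (T : lmodType F)
    (p : nat) (tp : T -> T -> T -> T) (pm : T -> T) : Prop :=
  IsRestrictedPrelieTripleSystem {
  rplts_plts : is_prelie_triple_system tp;
  rplts_scale : forall (a : F) x, pm (a *: x) = a ^+ p *: pm x;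
  rplts_mid : forall x y z,
    tp x (pm y) z = tp (iter (p.-1)./2 (prelie_theta tp y y) x) y z;
  rplts_last : forall x y z,
    tp x y (pm z) = iter (p.-1)./2 (prelie_theta tp z z) (tp x y z);
  rplts_bracket : forall x y z,
    prelie_comm tp x (pm y) z =
      nbracket (prelie_comm tp) x (rcons (nseq p y) z);
  rplts_add : forall x y,
    pm (x + y) = pm x + pm y
                 + \sum_(1 <= i < p) s_coef p (prelie_comm tp) i x y
}.

(* Main.v *)
Require Import Defs.
From HB Require Import structures.
From mathcomp Require Import all_boot all_order all_algebra.
From mathcomp Require Import boolp functions.

(* A Lie triple system T embeds in the Lie algebra T + Der T, with T as its odd
   part and D u = [-, u] a derivation.  Expanding by the Leibniz rule,
     sum_(j < n) D^(n-1-j) [D^j X, a] = sum_(m < n) 'C(n, m) [D^m X, D^(n-1-m) a];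
   in characteristic p the right side is [X, D^(p-1) a] for n = p, and for
   n = p - 1 it is symmetric in X and a (both odd), since 'C(p-1, m) = (-1)^m.
   The case n = p yields [x, y^[p]', z]_C = (x, y, ..., y, z)_C, and Leibniz
   for D^p yields [x, y, z^[p]] = ([x, y, z], z, ..., z).
   For the additivity of x |-> (x, Px, ..., Px), work in T[[t]] and put
   W(t) = (V, U, ..., U) with V = tx + y and U = P V.  The symmetry for
   n = p - 1 identifies the derivative W'(t) with (x, tx + y, ..., tx + y)_C.
   So the middle coefficients of W are the s_i(x, y), the extreme ones are
   y^[p]' and x^[p]', and W(1) = (x + y)^[p]'. *)

Import GRing.Theory.
Local Open Scope ring_scope.

Set Implicit Arguments.
Unset Strict Implicit.
Unset Printing Implicit Defensive.

(** * Iterated derivations and binomial coefficients modulo p *)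

Section Leibniz.
Context (V : zmodType) (D : {additive V -> V}) (B : nat -> nat -> V).
Hypothesis D_leibniz : forall m n, D (B m n) = B m.+1 n + B m n.+1.

(** [B m n] abstracts [D^m X, D^n Y]; the induction is Pascal's rule. *)
Lemma iter_leibniz n :
  iter n D (B 0 0) = \sum_(m < n.+1) B m (n - m)%N *+ 'C(n, m).
Proof.
elim: n => [|n IHn]; first by rewrite big_ord1.
rewrite iterS IHn raddf_sum.
under eq_bigr => m _ do rewrite raddfMn D_leibniz mulrnDl.
rewrite big_split /= [RHS]big_ord_recl /= bin0.
under [X in _ = _ + X]eq_bigr => m _ do
  rewrite /bump /= add1n binS subSS mulrnDr.
rewrite big_split /= [RHS]addrA [LHS]addrC; congr (_ + _).
rewrite big_ord_recl /= bin0 !subn0 big_ord_recr /= bin_small // addr0.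
by congr (_ + _); apply: eq_bigr => i _; rewrite /bump add1n subnSK.
Qed.

(** Reading [B m n] as a^m b^n and [D] as a + b, the left side is the geometric sum ((a + b)^(N+1) -
    a^(N+1)) / b, whose expansion is the right side. *)
Lemma sum_iter_leibniz N :
  \sum_(j < N.+1) iter (N - j) D (B j 0)
    = \sum_(m < N.+1) B m (N - m)%N *+ 'C(N.+1, m).
Proof.
elim: N => [|N IHN]; first by rewrite !big_ord1.
rewrite big_ord_recr subnn /=.
have leN (m : 'I_N.+1) : (m <= N)%N by rewrite -ltnS.
under eq_bigr => m _ do rewrite (subSn (leN m)) iterS.
rewrite -raddf_sum IHN raddf_sum.
under [X in X + _]eq_bigr => m _ do
  rewrite raddfMn D_leibniz mulrnDl -(subSn (leN m)).
rewrite big_split /= -addrA.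
have -> : \sum_(i < N.+1) B i (N.+1 - i)%N *+ 'C(N.+1, i) + B N.+1 0
    = \sum_(i < N.+2) B i (N.+1 - i)%N *+ 'C(N.+1, i).
  by rewrite [RHS]big_ord_recr /= binn subnn.
rewrite [X in _ + X = _]big_ord_recl [RHS]big_ord_recl /= !bin0 addrCA.
congr (_ + _); rewrite addrC -big_split /=; apply: eq_bigr => i _.
by rewrite /bump add1n subSS -mulrnDr -binS.
Qed.

End Leibniz.

(** Two neighbours in row p - 1 of Pascal's triangle add up to an inner entry of row p, which is 0
    modulo p; so the signs alternate. *)
Lemma bin_predn_pchar (R : nzRingType) p m :
  p \in [pchar R] -> (m < p)%N -> 'C(p.-1, m)%:R = (-1) ^+ m :> R.
Proof.
move=> pR; have p_gt0 := prime_gt0 (pcharf_prime pR).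
elim: m => [|m IHm] ltmp; first by rewrite bin0.
have := binS p.-1 m; rewrite prednK // => /(congr1 (fun n => n%:R : R)).
rewrite natrD IHm ?(ltnW ltmp) //.
have /eqP-> : ('C(p, m.+1)%:R == 0 :> R).
  by rewrite -(dvdn_pcharf pR) prime_dvd_bin ?(pcharf_prime pR).
by move/esym/eqP; rewrite addr_eq0 => /eqP->; rewrite exprS mulN1r.
Qed.

Lemma mulrn_pchar (F : fieldType) (V : lmodType F) p n (v : V) :
  p \in [pchar F] -> (p %| n)%N -> v *+ n = 0.
Proof. by move=> pF; rewrite (dvdn_pcharf pF) -scaler_nat => /eqP->; rewrite scale0r. Qed.

(** * Calculus of trilinear brackets *)

Section Trilinear.
Context (F : fieldType) (T : lmodType F) (br : T -> T -> T -> T).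
Hypothesis br_lin : is_trilinear br.

(** Turns propositional linearity into a bundled map, so that the generic lemmas on additive and
    linear maps apply in each slot of [br]. *)
Lemma linear_fun_lift (U V : lmodType F) (f : U -> V) :
  linear f -> exists g : {linear U -> V}, g =1 f.
Proof.
move=> fL; pose fM := GRing.isLinear.Build F U V _ f fL.
pose g : {linear U -> V} := HB.pack f fM.
by exists g.
Qed.

Lemma br1_lift y z : exists g : {linear T -> T}, forall x, g x = br x y z.
Proof. by case: br_lin => h _ _; apply: (linear_fun_lift (h y z)). Qed.
Lemma br2_lift x z : exists g : {linear T -> T}, forall y, g y = br x y z.
Proof. by case: br_lin => _ h _; apply: (linear_fun_lift (h x z)). Qed.
Lemma br3_lift x y : exists g : {linear T -> T}, forall z, g z = br x y z.
Proof. by case: br_lin => _ _ h; apply: (linear_fun_lift (h x y)). Qed.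

Lemma br1D a b y z : br (a + b) y z = br a y z + br b y z.
Proof. by have [g gE] := br1_lift y z; rewrite -!gE raddfD. Qed.
Lemma br2D a b x z : br x (a + b) z = br x a z + br x b z.
Proof. by have [g gE] := br2_lift x z; rewrite -!gE raddfD. Qed.
Lemma br3D a b x y : br x y (a + b) = br x y a + br x y b.
Proof. by have [g gE] := br3_lift x y; rewrite -!gE raddfD. Qed.
Lemma br1N a y z : br (- a) y z = - br a y z.
Proof. by have [g gE] := br1_lift y z; rewrite -!gE raddfN. Qed.
Lemma br1_0 y z : br 0 y z = 0.
Proof. by have [g gE] := br1_lift y z; rewrite -!gE raddf0. Qed.
Lemma br2_0 x z : br x 0 z = 0.
Proof. by have [g gE] := br2_lift x z; rewrite -!gE raddf0. Qed.
Lemma br3_0 x y : br x y 0 = 0.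
Proof. by have [g gE] := br3_lift x y; rewrite -!gE raddf0. Qed.
Lemma br1Z c a y z : br (c *: a) y z = c *: br a y z.
Proof. by have [g gE] := br1_lift y z; rewrite -!gE linearZ. Qed.
Lemma br2Z c a x z : br x (c *: a) z = c *: br x a z.
Proof. by have [g gE] := br2_lift x z; rewrite -!gE linearZ. Qed.
Lemma br3Z c a x y : br x y (c *: a) = c *: br x y a.
Proof. by have [g gE] := br3_lift x y; rewrite -!gE linearZ. Qed.
Lemma br1Mn n a y z : br (a *+ n) y z = br a y z *+ n.
Proof. by have [g gE] := br1_lift y z; rewrite -!gE raddfMn. Qed.
Lemma br2Mn n a x z : br x (a *+ n) z = br x a z *+ n.
Proof. by have [g gE] := br2_lift x z; rewrite -!gE raddfMn. Qed.
Lemma br3Mn n a x y : br x y (a *+ n) = br x y a *+ n.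
Proof. by have [g gE] := br3_lift x y; rewrite -!gE raddfMn. Qed.
Lemma br1_sum I r (Q : pred I) f y z :
  br (\sum_(i <- r | Q i) f i) y z = \sum_(i <- r | Q i) br (f i) y z.
Proof.
have [g gE] := br1_lift y z; rewrite -gE raddf_sum.
by apply: eq_bigr => i _; exact: gE.
Qed.

End Trilinear.

(** * The Lie algebra around a Lie triple system *)

Section Embedding.
Context (F : fieldType) (T : lmodType F) (br : T -> T -> T -> T).
Hypothesis br_lts : is_lie_triple_system br.

Let br_lin : is_trilinear br := lts_trilinear br_lts.
Let br1D := br1D br_lin.
Let br3D := br3D br_lin.
Let br1N := br1N br_lin.

(** The cyclic identity in derivation form: [[x, y], z] = [[x, z], y] + [x, [y, z]]. *)
Lemma br_jacobi x y z : br x y z = br x z y - br y z x.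
Proof.
have := lts_cyclic br_lts x y z; rewrite (lts_antisym br_lts z x y) => /eqP.
by rewrite -addrA addr_eq0 opprB => /eqP.
Qed.

(* The element (x, f) stands for x + f, with f in the role of a derivation. *)
Definition env : Type := (T * (T -> T))%type.
HB.instance Definition _ := GRing.Lmodule.on env.

Definition odd_part (x : T) : env := (x, 0).

Lemma odd_part_is_zmod_morphism : zmod_morphism odd_part.
Proof. by move=> x y; rewrite /odd_part; congr pair; rewrite subr0. Qed.
HB.instance Definition _ :=
  GRing.isZmodMorphism.Build T env odd_part odd_part_is_zmod_morphism.

(* Right bracketing by the odd element u: it exchanges the two parities. *)
Definition ract (u : T) (X : env) : env := (X.2 u, br X.1 u).

Lemma ract_is_zmod_morphism u : zmod_morphism (ract u).
Proof.
move=> [x f] [y g]; congr pair; apply/funext => z /=.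
by rewrite br1D br1N.
Qed.
HB.instance Definition _ u :=
  GRing.isZmodMorphism.Build env env (ract u) (ract_is_zmod_morphism u).

Lemma ractD u X Y : ract u (X + Y) = ract u X + ract u Y.
Proof. exact: raddfD. Qed.

(** Two odd elements bracket to the operator [br x y], an operator and an odd element to the value,
    two operators to their commutator. As [env] contains all functions, the laws below assume
    [is_der] of the second components. *)
Definition lie (X Y : env) : env :=
  (X.2 Y.1 - Y.2 X.1,
   fun z => br X.1 Y.1 z + X.2 (Y.2 z) - Y.2 (X.2 z)).

Definition is_der (f : T -> T) :=
  (forall x y, f (x + y) = f x + f y) /\
  (forall x y z, f (br x y z) = br (f x) y z + br x (f y) z + br x y (f z)).

Lemma is_der0 : is_der 0.
Proof.
split=> * /=; first by rewrite addr0.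
by rewrite (br1_0 br_lin) (br2_0 br_lin) (br3_0 br_lin) !addr0.
Qed.

Lemma ract_der u X : is_der (ract u X).2.
Proof.
by split => x y * /=; [rewrite br3D | rewrite (lts_deriv br_lts)].
Qed.

(** This is the Jacobi identity with one odd entry. Its odd component reduces to [br_jacobi], its
    even one to the derivation rules of [f] and [g]. *)
Lemma ract_lie u X Y : is_der X.2 -> is_der Y.2 ->
  ract u (lie X Y) = lie (ract u X) Y + lie X (ract u Y).
Proof.
case: X Y => [x f] [y g] /= fder gder; have [fD fbr] := fder; have [gD gbr] := gder.
congr pair => /=.
  by rewrite (br_jacobi x y u) -addrA addrACA [RHS]addrACA [- _ - _ in RHS]addrC.
apply/funext => z; rewrite /= !fctE br1D br1N fbr gbr.
rewrite (lts_antisym br_lts (f u) y z).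
set d := br (f y) u z; set b := br (g x) u z; set q := br y (f u) z.
set a := br x u (g z); set c := br x (g u) z; set e := br y u (f z).
rewrite (addrC (b + c) a) opprD (addrA (- q + a)) addrK (addrA c) addrK.
rewrite [RHS]addrC (addrC c) -opprD (addrC q) -(addrA d) -(addrA b).
by rewrite (addrC c) opprD [RHS]addrACA subrr addr0.
Qed.

Lemma lieC X Y : lie X Y = - lie Y X.
Proof.
congr pair => /=; first by rewrite opprB.
apply/funext => z; rewrite /= !fctE (lts_antisym br_lts).
by rewrite !opprD opprK -!addrA; congr (_ + _); rewrite addrC.
Qed.

Lemma lie_odd X a : is_der X.2 -> lie X (odd_part a) = ract a X.
Proof.
move=> Xder; have X0 : X.2 0 = 0.
  by have [XD _] := Xder; apply: (addrI (X.2 0)); rewrite -XD !addr0.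
congr pair => /=; first by rewrite subr0.
by apply/funext => z; rewrite X0 addr0 subr0.
Qed.

Lemma iter_ract_der u x n : is_der (iter n (ract u) (odd_part x)).2.
Proof. by case: n => [|n]; [exact: is_der0 | exact: ract_der]. Qed.

(** Of two successive steps, the first produces the operator [br x u] and the second evaluates it at
    [u]. *)
Lemma iter_ract_even u x k :
  iter k.*2 (ract u) (odd_part x) = odd_part (nbracket br x (nseq k.*2 u)).
Proof.
elim: k x => //= k IHk x; rewrite -IHk -!iterS -addn2 iterD /=.
congr iter; congr pair => /=.
by apply/funext => z; rewrite (br1_0 br_lin).
Qed.

Lemma nbracketSr x u k :
  nbracket br x (nseq k.+1.*2 u) = br (nbracket br x (nseq k.*2 u)) u u.
Proof. by elim: k x => //= k IHk x; rewrite IHk. Qed.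

(* The derivative of [iter n (ract u) X] in the direction [a] of [u]. *)
Definition polar (u a : T) (n : nat) (X : env) : env :=
  \sum_(j < n) iter (n - j.+1) (ract u) (ract a (iter j (ract u) X)).

Lemma polarS u a n X :
  polar u a n.+1 X = ract u (polar u a n X) + ract a (iter n (ract u) X).
Proof.
rewrite /polar big_ord_recr /= subnn raddf_sum; congr (_ + _).
by apply: eq_bigr => i _; rewrite subSn.
Qed.

(** On these iterates [ract a] is the bracket with [odd_part a], so [polar] is a sum as in
    [sum_iter_leibniz]. *)
Lemma polar_leibniz u a n x :
  polar u a n.+1 (odd_part x) =
  \sum_(m < n.+1) lie (iter m (ract u) (odd_part x))
                      (iter (n - m) (ract u) (odd_part a)) *+ 'C(n.+1, m).
Proof.
pose B i j := lie (iter i (ract u) (odd_part x)) (iter j (ract u) (odd_part a)).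
rewrite -[RHS](sum_iter_leibniz (D := ract u) (B := B)); last first.
  by move=> i j; apply: ract_lie; apply: iter_ract_der.
apply: eq_bigr => i _; rewrite subSS; congr iter.
by rewrite /B lie_odd //; apply: iter_ract_der.
Qed.

(** Variation of constants: [w] solves the linearization, in direction [a], of the recursion of [v].
    It serves both for powers under the Rota-Baxter bracket and for derivatives of polynomial
    powers. *)
Lemma polar_eq k u a (w v : nat -> T) :
    (forall i, w i.+1 = br (w i) u u + br (v i) a u + br (v i) u a) ->
    (forall i, v i.+1 = br (v i) u u) ->
  odd_part (w k) = iter k.*2 (ract u) (odd_part (w 0%N))
                   + polar u a k.*2 (odd_part (v 0%N)).
Proof.
move=> wS vS.
have vE i : odd_part (v i) = iter i.*2 (ract u) (odd_part (v 0%N)).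
  elim: i => //= i <-; rewrite vS; congr pair.
  by apply/funext => z; rewrite (br1_0 br_lin).
elim: k => [|k IHk]; first by rewrite /polar big_ord0 addr0.
rewrite doubleS !polarS.
rewrite iterS -(vE k) ractD !addrA.
have -> : iter k.*2.+2 (ract u) (odd_part (w 0%N))
    + ract u (ract u (polar u a k.*2 (odd_part (v 0%N))))
    = ract u (ract u (odd_part (w k))).
  by rewrite IHk !ractD.
rewrite wS; congr pair => /=; rewrite -(vE k) //.
by apply/funext => z; rewrite !fctE /= !(br1_0 br_lin) !addr0.
Qed.

(** * The embedding in characteristic p *)

Context (p : nat).
Hypotheses (charFp : p \in [pchar F]) (p_gt2 : (2 < p)%N).

Let p_odd : odd p.
Proof.
by case: (even_prime (pcharf_prime charFp)) p_gt2 => // ->.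
Qed.

Lemma half_predn : p.-1 = (p.-1)./2.*2.
Proof. by rewrite even_halfK // -subn1 oddB ?p_odd // ltnW // ltnW. Qed.

Lemma polar_p u a x :
  polar u a p (odd_part x)
    = lie (odd_part x) (iter p.-1 (ract u) (odd_part a)).
Proof.
have p_pr := pcharf_prime charFp.
have [q pE] : exists q, p = q.+1 by exists p.-1; rewrite prednK ?prime_gt0.
rewrite [in LHS]pE polar_leibniz big_ord_recl bin0 subn0 big1.
  by rewrite addr0 pE.
move=> i _; apply: (mulrn_pchar (p := p)) => //.
by rewrite /= /bump add1n -pE prime_dvd_bin //= [ltnRHS]pE ltnS.
Qed.

Lemma polar_sym u a x :
  polar u a p.-1 (odd_part x) = polar u x p.-1 (odd_part a).
Proof.
have [q pE] : exists q, p = q.+2 by case: p p_gt2 => [|[|q]] // _; exists q.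
have binE m : (m < q.+2)%N -> 'C(q.+1, m)%:R = (-1) ^+ m :> F.
  by move=> ltmq; rewrite -(bin_predn_pchar (p := p)) ?pE // -pE.
have q_odd : odd q by have := p_odd; rewrite pE /= negbK.
have -> : p.-1 = q.+1 by rewrite pE.
(* With q = p - 2, replacing m by q - m and flipping [lie] gives the sign -(-1)^(q-m), which is
   (-1)^m because q is odd. *)
rewrite !polar_leibniz (reindex_inj rev_ord_inj) /=.
apply: eq_bigr => m _; have lemq : (m <= q)%N by rewrite -ltnS.
rewrite subSS subKn // lieC -!(@scaler_nat F env) scalerN -scaleNr.
rewrite !binE ?(leq_ltn_trans lemq) ?(leq_ltn_trans (leq_subr _ _)) //.
by rewrite -[in LHS]signr_odd oddB // q_odd addTb signrN opprK signr_odd.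
Qed.

(* The even element [lie x y] acts by [br x y], so this says that the [p]-th
   power of [ract z] is again a derivation of the embedding. *)
Lemma nbracket_pchar x y z :
  nbracket br (br x y z) (nseq p.-1 z)
  = br (nbracket br x (nseq p.-1 z)) z y - br (nbracket br y (nseq p.-1 z)) z x.
Proof.
pose D := ract z.
pose B i j := lie (iter i D (odd_part x)) (iter j D (odd_part y)).
have BE : B 0%N 0%N = ract y (odd_part x) by rewrite -lie_odd //; exact: is_der0.
(* As p is odd, the first p - 1 steps end in the odd part and the last one yields an operator. *)
have DpE w : iter p D (odd_part w) = (0, br (nbracket br w (nseq p.-1 z)) z).
  rewrite -[in LHS](prednK (prime_gt0 (pcharf_prime charFp))) iterS.
  by rewrite half_predn iter_ract_even.
have : iter p D (B 0%N 0%N) = B p 0%N + B 0%N p.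
  have [q pE] : exists q, p = q.+2 by case: p p_gt2 => [|[|q]] // _; exists q.
  rewrite (iter_leibniz (D := D) (B := B)); last first.
    by move=> i j; apply: ract_lie; apply: iter_ract_der.
  rewrite pE big_ord_recl big_ord_recr /= big1 => [|i _].
    by rewrite add0r addrC bin0 subn0 /bump add1n subnn binn.
  apply: (mulrn_pchar (p := p)) => //.
  by rewrite /bump add1n -pE prime_dvd_bin ?(pcharf_prime charFp) //= pE ltnS.
(* The first of the p factors sends [x, y] to [br x y z]; the other p - 1 give the left side, and
   odd components are compared. *)
rewrite BE /B !DpE /= -{1}(prednK (prime_gt0 (pcharf_prime charFp))) iterSr.
have -> : D (ract y (odd_part x)) = odd_part (br x y z).
  congr pair; apply/funext => w /=; exact: (br1_0 br_lin).
rewrite {1}half_predn iter_ract_even -half_predn => /(congr1 fst) /= ->.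
by rewrite subr0 sub0r.
Qed.

End Embedding.

(** * The bracket induced by a Rota-Baxter operator *)

Section RotaBaxterBracket.
Context (F : fieldType) (T : lmodType F) (br : T -> T -> T -> T) (P : T -> T).

(** The expanded form of [x, y, z]_C. [P] is a plain function here, so that the section also applies
    to [comp P] on coefficient sequences. *)
Definition rb_bracket (x y z : T) : T :=
  br x (P y) (P z) + br (P x) y (P z) + br (P x) (P y) z.

Hypothesis br_lts : is_lie_triple_system br.
Hypothesis P_rb : forall x y z, P (rb_bracket x y z) = br (P x) (P y) (P z).

Lemma rb_nbracket x y k :
  P (nbracket rb_bracket x (nseq k.*2 y)) = nbracket br (P x) (nseq k.*2 (P y)).
Proof. by elim: k => //= k IHk in x *; rewrite IHk P_rb. Qed.

(** Since [P] maps the powers [w] to the powers [v], the three terms of [rb_bracket] are exactly the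
    recursion of [polar_eq] with direction [y]. *)
Lemma odd_part_rb_nbracket x y k :
  odd_part (nbracket rb_bracket x (nseq k.*2 y))
  = odd_part (nbracket br x (nseq k.*2 (P y)))
    + polar br (P y) y k.*2 (odd_part (P x)).
Proof.
pose w i := nbracket rb_bracket x (nseq i.*2 y).
pose v i := nbracket br (P x) (nseq i.*2 (P y)).
rewrite -(iter_ract_even br_lts).
apply: (polar_eq br_lts k (u := P y) (a := y) (w := w) (v := v)) => i; last exact: nbracketSr.
by rewrite /w nbracketSr /rb_bracket rb_nbracket.
Qed.

(** Split the last step off [polar_p], express the remaining [polar] at p - 1 by
    [odd_part_rb_nbracket], and evaluate the even component at [P z]. *)
Lemma rb_nbracket_pchar p x y z : p \in [pchar F] -> (2 < p)%N ->
  br (nbracket rb_bracket x (nseq p.-1 y)) (P y) (P z)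
    + br (nbracket br (P x) (nseq p.-1 (P y))) y (P z)
  = br (nbracket br x (nseq p.-1 (P y))) (P y) (P z)
    + br (P x) (nbracket br y (nseq p.-1 (P y))) (P z).
Proof.
move=> charFp p_gt2; have pE := half_predn charFp p_gt2.
have := polar_p br_lts charFp (P y) y (P x).
rewrite -{1}(prednK (prime_gt0 (pcharf_prime charFp))) (polarS br_lts) pE.
rewrite !(iter_ract_even br_lts).
have := odd_part_rb_nbracket x y (p.-1)./2.
move/eqP; rewrite addrC -subr_eq => /eqP <-.
move/(congr1 (fun X : env T => X.2 (P z))) => /=; rewrite fctE /=.
rewrite (br1D (lts_trilinear br_lts)) (br1N (lts_trilinear br_lts)).
rewrite addr0 subr0 => <-.
by rewrite addrA (addrC _ (_ - _)) subrK.
Qed.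

(** After [P_rb] has resolved the nested brackets, every term has exactly one argument outside [P].
    Grouped by that argument, each identity becomes a sum of instances of the same identity for
    [br]. *)
Lemma rb_bracket_lts :
  (forall a x y, P (a *: x + y) = a *: P x + P y) ->
  is_lie_triple_system rb_bracket.
Proof.
have br_lin := lts_trilinear br_lts.
have antisym := lts_antisym br_lts.
have deriv := lts_deriv br_lts.
move=> P_lin; split.
- split=> [y z|x z|x y] a u v; rewrite /rb_bracket !P_lin.
  + rewrite !(br1D br_lin) !(br1Z br_lin) !scalerDr.
    by rewrite [LHS](AC (2*2*2) ((1*3*5)*(2*4*6))).
  + rewrite !(br2D br_lin) !(br2Z br_lin) !scalerDr.
    by rewrite [LHS](AC (2*2*2) ((1*3*5)*(2*4*6))).
  + rewrite !(br3D br_lin) !(br3Z br_lin) !scalerDr.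
    by rewrite [LHS](AC (2*2*2) ((1*3*5)*(2*4*6))).
- move=> x y z; rewrite /rb_bracket (antisym x) (antisym (P x) y).
  by rewrite (antisym (P x) (P y)) -!opprD [X in - (X + _)]addrC.
- move=> x y z; rewrite /rb_bracket.
  have h a b c := lts_cyclic br_lts a b c.
  rewrite [LHS](AC (3*3*3) ((1*6*8)*(2*4*9)*(3*5*7))) /=.
  by rewrite !h !addr0.
move=> u v x y z; have E a b c : rb_bracket a b c =
  br a (P b) (P c) + br (P a) b (P c) + br (P a) (P b) c by [].
rewrite (E u v) (E (rb_bracket _ _ _)) (E x (rb_bracket _ _ _)).
rewrite (E x y (rb_bracket _ _ _)) !P_rb !E.
rewrite !(br1D br_lin) !(br2D br_lin) !(br3D br_lin).
rewrite (deriv u (P v) (P x)) (deriv (P u) v (P x)) (deriv (P u) (P v) x).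
rewrite (deriv (P u) (P v) (P x) y) (deriv (P u) (P v) (P x) (P y) z).
by rewrite [LHS](AC ((3*3)*(3*3*3))
  ((((1*4*7)*10*13)*(8*(2*5*11)*14))*(9*12*(3*6*15)))) /=.
Qed.

End RotaBaxterBracket.

(** * Sequences of coefficients: brackets and derivatives *)

Section PolyBracket.
Context (F : fieldType) (T : lmodType F) (br : T -> T -> T -> T).
Hypothesis br_lin : is_trilinear br.

Lemma sum_ord_widen0 (n N : nat) (f : nat -> T) :
    (n <= N)%N -> (forall i, (n <= i)%N -> f i = 0) ->
  \sum_(i < n) f i = \sum_(i < N) f i.
Proof.
move=> lenN f0; rewrite (big_ord_widen _ f lenN) big_mkcond /=.
by apply: eq_bigr => i _; case: ltnP => // /f0.
Qed.

(** Moving the degree condition into a multiplicity 0 or 1, with freely chosen bounds, lets the sums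
    be exchanged and matched. *)
Lemma poly_bracketE N1 N2 N3 f g h k : (k < N1)%N -> (k < N2)%N -> (k < N3)%N ->
  poly_bracket br f g h k =
  \sum_(a < N1) \sum_(b < N2) \sum_(c < N3)
     br (f a) (g b) (h c) *+ (a + b + c == k)%N.
Proof.
move=> ltk1 ltk2 ltk3; pose G a b c := br (f a) (g b) (h c) *+ (a + b + c == k)%N.
have G0 a b c : (k < a + b + c)%N -> G a b c = 0.
  by rewrite /G => /gtn_eqF ->.
rewrite -(@sum_ord_widen0 k.+1 N1 (fun a => \sum_(b < N2) \sum_(c < N3) G a b c)) //.
  apply: eq_bigr => a _.
  rewrite -(@sum_ord_widen0 k.+1 N2 (fun b => \sum_(c < N3) G a b c)) //.
    apply: eq_bigr => b _.
    rewrite -(@sum_ord_widen0 k.+1 N3 (G a b)) // => [|i ltki].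
      by rewrite big_mkcond; apply: eq_bigr => c _; rewrite /G mulrb.
    by rewrite G0 // ltn_addl.
  by move=> i ltki; apply: big1 => c _; rewrite G0 // ltn_addr // ltn_addl.
move=> i ltki; apply: big1 => b _; apply: big1 => c _.
by rewrite G0 // -addnA ltn_addr.
Qed.

(** Flattens a nested bracket: only m = a + b + c contributes, and when a + b + c reaches N both
    sides vanish since k < N. *)
Lemma sum_poly_bracket (phi : {additive T -> T}) N n k f g h : (k < N)%N ->
  \sum_(m < N) phi (poly_bracket br f g h m) *+ (n + m == k)%N =
  \sum_(a < N) \sum_(b < N) \sum_(c < N)
     phi (br (f a) (g b) (h c)) *+ (n + (a + b + c) == k)%N.
Proof.
move=> ltkN; under eq_bigr => m _.
  rewrite (poly_bracketE _ _ _ (ltn_ord m) (ltn_ord m) (ltn_ord m)) raddf_sum.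
  rewrite -sumrMnl; under eq_bigr => a _.
    rewrite raddf_sum -sumrMnl; under eq_bigr => b _.
      by rewrite raddf_sum -sumrMnl; over.
    by over.
  by over.
rewrite exchange_big; apply: eq_bigr => a _ /=.
rewrite exchange_big; apply: eq_bigr => b _ /=.
rewrite exchange_big; apply: eq_bigr => c _ /=.
under eq_bigr => m _ do rewrite raddfMn -mulrnA mulnb.
have [ltN|leN] := ltnP (a + b + c) N.
  rewrite (bigD1 (Ordinal ltN)) //= eqxx big1 ?addr0 // => m.
  by rewrite -val_eqE /= eq_sym => /negPf ->.
rewrite gtn_eqF ?(leq_trans ltkN) ?(leq_trans leN) ?leq_addl // big1 // => m _.
by rewrite gtn_eqF // (leq_trans (ltn_ord m)).
Qed.

Lemma poly_bracket_trilinear : is_trilinear (poly_bracket br : (nat -> T) -> _).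
Proof.
split=> [g h|f h|f g] c u v; apply/funext => k /=; rewrite !fctE /poly_bracket.
all: rewrite scaler_sumr -big_split; apply: eq_bigr => i _ /=.
all: rewrite scaler_sumr -big_split; apply: eq_bigr => j _ /=.
all: rewrite scaler_sumr -big_split; apply: eq_bigr => l _ /=.
- by rewrite (br1D br_lin) (br1Z br_lin).
- by rewrite (br2D br_lin) (br2Z br_lin).
- by rewrite (br3D br_lin) (br3Z br_lin).
Qed.

Definition poly_deriv (f : nat -> T) : nat -> T := fun k => f k.+1 *+ k.+1.

Lemma poly_bracket_deriv f g h :
  poly_deriv (poly_bracket br f g h) =
  poly_bracket br (poly_deriv f) g h + poly_bracket br f (poly_deriv g) h
  + poly_bracket br f g (poly_deriv h).
Proof.
apply/funext => k; rewrite !fctE /poly_deriv.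
have [lt1 lt2] : (k < k.+1 /\ k < k.+2)%N by split; rewrite ltnS.
rewrite (poly_bracketE _ _ _ (ltnSn _) (ltnSn _) (ltnSn _)).
(* The differentiated slot gets the bound k + 1, matching the other side once its index 0, of weight
   0, is dropped. *)
rewrite (poly_bracketE (fun k => f k.+1 *+ k.+1) g h lt1 lt2 lt2).
rewrite (poly_bracketE f (fun k => g k.+1 *+ k.+1) h lt2 lt1 lt2).
rewrite (poly_bracketE f g (fun k => h k.+1 *+ k.+1) lt2 lt2 lt1).
pose G a b c := br (f a) (g b) (h c) *+ (a + b + c == k.+1)%N.
(* The factor k + 1 equals a + b + c on every surviving term. *)
transitivity (\sum_(a < k.+2) \sum_(b < k.+2) \sum_(c < k.+2)
   (G a b c *+ a + G a b c *+ b + G a b c *+ c)).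
  rewrite -sumrMnl; apply: eq_bigr => a _.
  rewrite -sumrMnl; apply: eq_bigr => b _.
  rewrite -sumrMnl; apply: eq_bigr => c _.
  by rewrite -!mulrnDr /G; case: eqP => [->|]; rewrite ?mul0rn.
under eq_bigr => a _.
  by under eq_bigr => b _ do rewrite !big_split /=; rewrite !big_split /=; over.
rewrite !big_split /=; congr (_ + _ + _).
- rewrite big_ord_recl big1 => [|b _]; last by apply: big1 => c _; rewrite mulr0n.
  rewrite add0r; apply: eq_bigr => a _; apply: eq_bigr => b _.
  apply: eq_bigr => c _; rewrite /G /= /bump add1n !addSn eqSS.
  by rewrite mulrnAC (br1Mn br_lin).
- apply: eq_bigr => a _.
  rewrite big_ord_recl big1 => [|c _]; last by rewrite mulr0n.
  rewrite add0r; apply: eq_bigr => b _; apply: eq_bigr => c _.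
  rewrite /G /= /bump add1n addnS !addSn eqSS.
  by rewrite mulrnAC (br2Mn br_lin).
- apply: eq_bigr => a _; apply: eq_bigr => b _.
  rewrite big_ord_recl mulr0n add0r; apply: eq_bigr => c _.
  rewrite /G /= /bump add1n addnS eqSS.
  by rewrite mulrnAC (br3Mn br_lin).
Qed.

(** Multiplication by Z. *)
Definition poly_shift (f : nat -> T) : nat -> T :=
  fun k => if k is k'.+1 then f k' else 0.

Lemma poly_shift_sum (phi : {additive T -> T}) N (f : nat -> T) k i : (k < N)%N ->
  \sum_(a < N) phi (f a) *+ (a + i == k)%N = phi (iter i poly_shift f k).
Proof.
elim: i => [|i IHi] in k f *; move=> ltkN.
  rewrite (bigD1 (Ordinal ltkN)) //= addn0 eqxx big1 ?addr0 // => a.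
  by rewrite addn0 -val_eqE /= => /negPf ->.
case: k ltkN => [_|k ltkN].
  by rewrite raddf0 big1 // => a _; rewrite addnS.
under eq_bigr => a _ do rewrite addnS eqSS.
by rewrite IHi // ltnW.
Qed.

Lemma poly_bracket_Zxy f x y z t k :
  poly_bracket br f (poly_Zxy x y) (poly_Zxy z t) k =
  br (f k) y t + br (poly_shift f k) y z
  + (br (poly_shift f k) x t + br (poly_shift (poly_shift f) k) x z).
Proof.
have ltk : (k < k.+2)%N by rewrite ltnS.
rewrite (poly_bracketE _ _ _ ltk ltk ltk) exchange_big /=.
have S b (u : T) (v := poly_Zxy x y b) :
   \sum_(a < k.+2) \sum_(c < k.+2) br (f a) v (poly_Zxy z t c) *+ (a + b + c == k)%N
   = br (iter b poly_shift f k) v t + br (iter b.+1 poly_shift f k) v z.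
  rewrite exchange_big big_ord_recl [X in _ + X = _]big_ord_recl.
  rewrite [X in _ + (_ + X) = _]big1 /= => [|i _]; last first.
    by apply: big1 => a _; rewrite (br3_0 br_lin) mul0rn.
  have [g1 g1E] := br1_lift br_lin v t; have [g2 g2E] := br1_lift br_lin v z.
  rewrite addr0 -g1E -g2E; congr (_ + _).
    rewrite -(poly_shift_sum g1 f b ltk); apply: eq_bigr => a _.
    by rewrite addn0 /= -g1E.
  rewrite -iterS -(poly_shift_sum g2 f b.+1 ltk); apply: eq_bigr => a _.
  by rewrite /= /bump addn1 addnS -g2E.
rewrite big_ord_recl [X in _ + X = _]big_ord_recl.
rewrite [X in _ + (_ + X) = _]big1 /= => [|i _]; last first.
  by apply: big1 => a _; apply: big1 => c _; rewrite (br2_0 br_lin) mul0rn.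
by rewrite addr0 (S 0%N) // (S 1%N).
Qed.

End PolyBracket.

(** * Extension of the Lie triple system to sequences *)

Section PolyLts.
Context (F : fieldType) (T : lmodType F) (br : T -> T -> T -> T).
Hypothesis br_lts : is_lie_triple_system br.
Let br_lin : is_trilinear br := lts_trilinear br_lts.

Lemma exchange_big22 (V : zmodType) N (G : 'I_N -> 'I_N -> 'I_N -> 'I_N -> V) :
  \sum_i \sum_j \sum_a \sum_b G i j a b = \sum_a \sum_b \sum_i \sum_j G i j a b.
Proof.
rewrite pair_big [RHS]pair_big /=; under eq_bigr => i _ do rewrite pair_big /=.
by rewrite exchange_big; apply: eq_bigr => i _; rewrite pair_big.
Qed.

Lemma poly_bracket_lts : is_lie_triple_system (poly_bracket br : (nat -> T) -> _).
Proof.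
split; first exact: poly_bracket_trilinear.
- move=> f g h; apply/funext => k; rewrite fctE.
  rewrite !(poly_bracketE br _ _ _ (ltnSn k) (ltnSn k) (ltnSn k)) exchange_big -sumrN.
  apply: eq_bigr => a _; rewrite -sumrN; apply: eq_bigr => b _.
  rewrite -sumrN; apply: eq_bigr => c _.
  by rewrite (lts_antisym br_lts) mulNrn (addnC b).
- move=> f g h; apply/funext => k; rewrite !fctE.
  rewrite !(poly_bracketE br _ _ _ (ltnSn k) (ltnSn k) (ltnSn k)).
  under [X in _ + X + _]eq_bigr => a _ do rewrite exchange_big /=.
  rewrite [X in _ + X + _]exchange_big [X in _ + _ + X]exchange_big /=.
  under [X in _ + _ + X]eq_bigr => a _ do rewrite exchange_big /=.
  rewrite -!big_split big1 // => a _ /=.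
  rewrite -!big_split big1 // => b _ /=.
  rewrite -!big_split big1 // => c _ /=.
  rewrite (addnC (b + c)%N) (addnC c) (addnAC a) [(a + c + b)%N]addnAC addnA.
  by rewrite -!mulrnDl (lts_cyclic br_lts) mul0rn.
move=> u v x y z; apply/funext => k; rewrite !fctE.
set N := k.+1; have ltkN : (k < N)%N by rewrite ltnS.
(* The indices a, ..., e belong to u, v, x, y, z. All four nested brackets become fivefold sums with
   this one weight, and [lts_deriv] is applied termwise. *)
pose G a b c d e w : T := w *+ (a + b + (c + d + e) == k)%N.
have outer f g h := poly_bracketE br f g h ltkN ltkN ltkN.
rewrite (outer u) (outer _ y) (outer x _ z) (outer x y).
transitivity (\sum_(a < N) \sum_(b < N) \sum_(c < N) \sum_(d < N) \sum_(e < N)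
    G a b c d e (br (u a) (v b) (br (x c) (y d) (z e)))).
  apply: eq_bigr => a _; apply: eq_bigr => b _.
  have [phi phiE] := br3_lift br_lin (u a) (v b).
  under eq_bigr => m _ do rewrite -phiE.
  rewrite (sum_poly_bracket br phi (a + b)) //.
  by do 3!(apply: eq_bigr => ? _); rewrite /G -phiE.
under eq_bigr => a _.
  under eq_bigr => b _.
    under eq_bigr => c _.
      under eq_bigr => d _.
        under eq_bigr => e _ do rewrite (lts_deriv br_lts) /G !mulrnDl.
        by rewrite !big_split /=; over.
      by rewrite !big_split /=; over.
    by rewrite !big_split /=; over.
  by rewrite !big_split /=; over.
rewrite !big_split /=; congr (_ + _ + _).
(* In each of the three cases the indices of the inner bracket are moved innermost, where
   [sum_poly_bracket] applies. *)
- rewrite [RHS]exchange_big /=.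
  under [RHS]eq_bigr => d _ do rewrite exchange_big /=.
  transitivity (\sum_(d < N) \sum_(e < N) \sum_(a < N) \sum_(b < N) \sum_(c < N)
      G a b c d e (br (br (u a) (v b) (x c)) (y d) (z e))).
    rewrite [RHS]exchange_big22; apply: eq_bigr => a _; apply: eq_bigr => b _.
    by rewrite exchange_big; apply: eq_bigr => d _; rewrite exchange_big.
  apply: eq_bigr => d _; apply: eq_bigr => e _.
  have [phi phiE] := br1_lift br_lin (y d) (z e).
  under [RHS]eq_bigr => m _ do rewrite -phiE -addnA addnC.
  rewrite (sum_poly_bracket br phi) //.
  do 3!(apply: eq_bigr => ? _); rewrite /G -phiE; congr (_ *+ nat_of_bool (_ == _)).
  by rewrite [LHS](AC (2*3) ((4*5)*(1*2*3))).
- under [RHS]eq_bigr => c _ do rewrite exchange_big /=.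
  transitivity (\sum_(c < N) \sum_(e < N) \sum_(a < N) \sum_(b < N) \sum_(d < N)
      G a b c d e (br (x c) (br (u a) (v b) (y d)) (z e))).
    rewrite [RHS]exchange_big22; apply: eq_bigr => a _; apply: eq_bigr => b _.
    by apply: eq_bigr => c _; rewrite exchange_big.
  apply: eq_bigr => c _; apply: eq_bigr => e _.
  have [phi phiE] := br2_lift br_lin (x c) (z e).
  under [RHS]eq_bigr => m _ do rewrite -phiE addnAC.
  rewrite (sum_poly_bracket br phi) //.
  do 3!(apply: eq_bigr => ? _); rewrite /G -phiE; congr (_ *+ nat_of_bool (_ == _)).
  by rewrite [LHS](AC (2*3) ((3*5)*(1*2*4))).
- transitivity (\sum_(c < N) \sum_(d < N) \sum_(a < N) \sum_(b < N) \sum_(e < N)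
      G a b c d e (br (x c) (y d) (br (u a) (v b) (z e)))).
    by rewrite [RHS]exchange_big22.
  apply: eq_bigr => c _; apply: eq_bigr => d _.
  have [phi phiE] := br3_lift br_lin (x c) (y d).
  under [RHS]eq_bigr => m _ do rewrite -phiE.
  rewrite (sum_poly_bracket br phi) //.
  do 3!(apply: eq_bigr => ? _); rewrite /G -phiE; congr (_ *+ nat_of_bool (_ == _)).
  by rewrite [LHS](AC (2*3) ((3*4)*(1*2*5))).
Qed.

End PolyLts.

(** * Coefficients of (Zx + y, Zu + v, ..., Zu + v) *)

Section PolyPower.
Context (F : fieldType) (T : lmodType F) (br : T -> T -> T -> T).
Hypothesis br_lin : is_trilinear br.
Context (x y u v : T).
Let W n : nat -> T :=
  nbracket (poly_bracket br) (poly_Zxy x y) (nseq n.*2 (poly_Zxy u v)).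

Let WS n k : W n.+1 k = br (W n k) v v + br (poly_shift (W n) k) v u
  + (br (poly_shift (W n) k) u v + br (poly_shift (poly_shift (W n)) k) u u).
Proof. by rewrite /W nbracketSr poly_bracket_Zxy. Qed.

Lemma poly_power_deg n k : (n.*2.+1 < k)%N -> W n k = 0.
Proof.
elim: n k => [|n IHn] [|[|k]] //; rewrite doubleS ltnS => ltnk.
rewrite WS /= !IHn ?(ltnW ltnk) //; last exact: ltnW (ltnW ltnk).
by rewrite !(br1_0 br_lin) !addr0.
Qed.

Lemma poly_power0 n : W n 0 = nbracket br y (nseq n.*2 v).
Proof. by elim: n => // n IHn; rewrite WS nbracketSr IHn /= !(br1_0 br_lin) !addr0. Qed.

Lemma poly_power_lead n : W n n.*2.+1 = nbracket br x (nseq n.*2 u).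
Proof.
elim: n => // n IHn; rewrite WS nbracketSr doubleS /= IHn.
by rewrite !poly_power_deg ?ltnS // !(br1_0 br_lin) !add0r.
Qed.

(** Evaluation at Z = 1, which does not see [poly_shift]; the bound exceeds the degree 2n + 1. *)
Lemma poly_power_sum n :
  \sum_(k < n.*2.+2) W n k = nbracket br (x + y) (nseq n.*2 (u + v)).
Proof.
elim: n => [|n IHn]; first by rewrite !big_ord_recl big_ord0 addr0 addrC.
have sum_shift f M : \sum_(k < M.+1) poly_shift f k = \sum_(k < M) f k :> T.
  by rewrite big_ord_recl add0r.
have sum_W M : (n.*2.+2 <= M)%N -> \sum_(k < M) W n k = \sum_(k < n.*2.+2) W n k.
  by move=> leM; rewrite -(sum_ord_widen0 leM) // => i /poly_power_deg.
rewrite nbracketSr; under eq_bigr => k _ do rewrite WS.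
rewrite !big_split /= -!(br1_sum br_lin) doubleS !sum_shift.
rewrite !sum_W ?IHn; do ?exact: leqW (leqW _); do ?exact: leqW.
by rewrite (br3D br_lin) !(br2D br_lin) addrC addrACA [RHS]addrC addrCA.
Qed.

End PolyPower.

(** The product rule makes the derivatives of the powers a solution of the recursion in [polar_eq],
    with direction g'. *)
Lemma poly_deriv_power (F : fieldType) (T : lmodType F)
    (br : T -> T -> T -> T) (br_lts : is_lie_triple_system br) (f g : nat -> T) n :
  odd_part (poly_deriv (nbracket (poly_bracket br) f (nseq n.*2 g)))
  = odd_part (nbracket (poly_bracket br) (poly_deriv f) (nseq n.*2 g))
    + polar (poly_bracket br) g (poly_deriv g) n.*2 (odd_part f).
Proof.
have pbr_lts := poly_bracket_lts br_lts.
pose v i := nbracket (poly_bracket br) f (nseq i.*2 g).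
rewrite -(iter_ract_even pbr_lts).
apply: (polar_eq pbr_lts n (u := g) (a := poly_deriv g)
  (w := fun i => poly_deriv (v i)) (v := v)) => i; last exact: nbracketSr.
by rewrite /v nbracketSr (poly_bracket_deriv (lts_trilinear br_lts)).
Qed.

(** * The p-map of a sum *)

Section RestrictedRotaBaxter.
Context (F : fieldType) (T : lmodType F) (p : nat) (br : T -> T -> T -> T).
Context (P : {linear T -> T}).
Hypotheses (charFp : p \in [pchar F]) (p_gt2 : (2 < p)%N).
Hypothesis br_lts : is_lie_triple_system br.
Hypothesis P_rb : is_rota_baxter br P.

Let rb := rb_bracket br P.
Let pm' (x : T) := nbracket br x (nseq p.-1 (P x)).

Lemma poly_bracket_rb : poly_bracket rb = rb_bracket (poly_bracket br) (comp P).
Proof.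
apply/funext => f; apply/funext => g; apply/funext => h; apply/funext => k.
rewrite /rb_bracket !fctE /poly_bracket -!big_split; apply: eq_bigr => a _ /=.
rewrite -!big_split; apply: eq_bigr => b _ /=.
by rewrite -!big_split.
Qed.

Lemma poly_deriv_rb_power x y :
  poly_deriv (nbracket (poly_bracket br) (poly_Zxy x y)
                (nseq p.-1 (poly_Zxy (P x) (P y))))
  = nbracket (poly_bracket rb) (poly_const x) (nseq p.-1 (poly_Zxy x y)).
Proof.
have pE := half_predn charFp p_gt2.
have br_lin := lts_trilinear br_lts.
have pbr_lts := poly_bracket_lts br_lts.
have compZ a b : P \o poly_Zxy a b = poly_Zxy (P a) (P b).
  by apply/funext => [[|[|k]]] //=; rewrite raddf0.
have compC a : P \o poly_const a = poly_const (P a).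
  by apply/funext => [[|k]] //=; rewrite raddf0.
have derivZ a b : poly_deriv (poly_Zxy a b) = poly_const a.
  by apply/funext => [[|k]] //; rewrite /poly_deriv mul0rn.
suff : odd_part (poly_deriv (nbracket (poly_bracket br) (poly_Zxy x y)
                (nseq p.-1 (poly_Zxy (P x) (P y)))))
  = odd_part (nbracket (poly_bracket rb) (poly_const x) (nseq p.-1 (poly_Zxy x y))).
  by move/(congr1 fst).
have P_prb f g h : comp P (rb_bracket (poly_bracket br) (comp P) f g h)
    = poly_bracket br (P \o f) (P \o g) (P \o h).
  rewrite -poly_bracket_rb; apply/funext => k; rewrite /= /poly_bracket.
  do 3!(rewrite raddf_sum; apply: eq_bigr => ? _).
  by rewrite P_rb.
rewrite poly_bracket_rb pE poly_deriv_power // (odd_part_rb_nbracket pbr_lts P_prb).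
rewrite !compZ compC !derivZ -!pE.
(* The two [polar] terms differ by exchanging the constant [P x] with Zx + y. *)
by rewrite (polar_sym pbr_lts charFp p_gt2).
Qed.

Lemma rb_pmap_add x y :
  pm' (x + y) = pm' x + pm' y + \sum_(1 <= i < p) s_coef p rb i x y.
Proof.
have br_lin := lts_trilinear br_lts.
have pE := half_predn charFp p_gt2; have p_pr := pcharf_prime charFp.
have p_gt0 := prime_gt0 p_pr.
pose W := nbracket (poly_bracket br) (poly_Zxy x y) (nseq p.-1 (poly_Zxy (P x) (P y))).
(* The coefficient of index i - 1 in W' is i times [W i], and i is invertible for 0 < i < p. *)
have sE i : (0 < i < p)%N -> s_coef p rb i x y = W i.
  case: i => // i /andP[_ ltip]; rewrite /s_coef -poly_deriv_rb_power.
  rewrite /poly_deriv -/W /= -scaler_nat scalerA mulVf ?scale1r //.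
  by rewrite -(dvdn_pcharf charFp) gtnNdvd.
rewrite big_nat; under eq_bigr => i ip do rewrite sE //.
rewrite -big_nat.
have := poly_power_sum br_lin x y (P x) (P y) (p.-1)./2.
have := poly_power0 br_lin x y (P x) (P y) (p.-1)./2.
have := poly_power_lead br_lin x y (P x) (P y) (p.-1)./2.
rewrite -raddfD -pE prednK // -/W /pm' => <- <- <-.
rewrite -(big_mkord xpredT W) big_nat_recr //= big_ltn //.
by rewrite addrC addrA.
Qed.

End RestrictedRotaBaxter.

(** * Verification of the axioms *)

Lemma nbracket_iter (F : fieldType) (T : lmodType F) (br : T -> T -> T -> T) x u k :
  nbracket br x (nseq k.*2 u) = iter k (fun w => br w u u) x.
Proof. by elim: k x => // k IHk x; rewrite iterSr -IHk. Qed.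

Lemma nbracket_rcons (F : fieldType) (T : lmodType F) (br : T -> T -> T -> T) x y z k :
  nbracket br x (rcons (nseq k.*2.+1 y) z) = br (nbracket br x (nseq k.*2 y)) y z.
Proof. by elim: k x => //= k IHk x; rewrite IHk. Qed.

Lemma nbracketZ (F : fieldType) (T : lmodType F) (br : T -> T -> T -> T)
    (br_lin : is_trilinear br) (a : F) x u k :
  nbracket br (a *: x) (nseq k.*2 (a *: u)) = a ^+ k.*2.+1 *: nbracket br x (nseq k.*2 u).
Proof.
elim: k => [|k IHk]; first by rewrite expr1.
rewrite !nbracketSr IHk (br1Z br_lin) (br2Z br_lin) (br3Z br_lin) !scalerA.
by rewrite -!exprSr doubleS.
Qed.

Theorem proposition5p27 (F : fieldType) (p : nat)
    (hp : p \in [pchar F]) (hp2 : (2 < p)%N)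
    (T : lmodType F) (br : T -> T -> T -> T) (pm : T -> T)
    (hT : is_restricted_lts p br pm)
    (P : {linear T -> T}) (hP : is_restricted_rota_baxter p br pm P) :
  let tp := fun x y z : T => br x (P y) (P z) in
  let pm' := fun x : T => nbracket br x (nseq p.-1 (P x)) in
  is_restricted_prelie_triple_system p tp pm' /\
  is_restricted_lts_morphism p (prelie_comm tp) pm' br pm P.
Proof.
move=> tp pm'.
have br_lts := rlts_lts hT; have br_lin := lts_trilinear br_lts.
have P_rb := rrb_rota_baxter hP; have P_pm := rrb_pmap hP.
have pm_br := rlts_bracket hT; have deriv := lts_deriv br_lts.
have pE := half_predn hp hp2.
have pSE : p = (p.-1)./2.*2.+1.
  by rewrite -pE prednK // prime_gt0 // (pcharf_prime hp).
have pm_mid x y z : br x (pm y) z = br (nbracket br x (nseq p.-1 y)) y z.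
  by rewrite pm_br pE {1}pSE nbracket_rcons.
(* [pm_mid] turns the right side of [nbracket_pchar] into [br x (pm z) y - br y (pm z) x]. *)
have pm_last x y z : br x y (pm z) = nbracket br (br x y z) (nseq p.-1 z).
  by rewrite (nbracket_pchar br_lts hp hp2) -!pm_mid; exact: br_jacobi.
have commE : prelie_comm tp = rb_bracket br P.
  apply/funext => x; apply/funext => y; apply/funext => z.
  rewrite /prelie_comm /rb_bracket /tp (lts_antisym br_lts (P x) y).
  rewrite -addrA (br_jacobi br_lts (P x) (P y)).
  rewrite (lts_antisym br_lts (P x) z) (lts_antisym br_lts (P y) z).
  by rewrite opprK [- _ + _]addrC.
have wedgeE x y z : prelie_wedge tp x y z = br (P x) (P y) z.
  rewrite /prelie_wedge /tp (br_jacobi br_lts (P x) (P y)).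
  rewrite (lts_antisym br_lts (P x) z) (lts_antisym br_lts (P y) z).
  by rewrite opprK [- _ + _]addrC.
have commP x y z : P (rb_bracket br P x y z) = br (P x) (P y) (P z).
  by rewrite P_rb.
have pm'Z a x : pm' (a *: x) = a ^+ p *: pm' x.
  by rewrite /pm' linearZ pE (nbracketZ br_lin) -pSE.
have pm'D x y : pm' (x + y) = pm' x + pm' y
    + \sum_(1 <= i < p) s_coef p (prelie_comm tp) i x y.
  by rewrite commE; exact: rb_pmap_add.
have pm'_br x y z : prelie_comm tp x (pm' y) z
    = nbracket (prelie_comm tp) x (rcons (nseq p y) z).
  (* Since [P (pm' y)] is [pm (P y)], [pm_mid] rewrites the first and third terms;
     [rb_nbracket_pchar] then trades the first two. *)
  rewrite commE pSE nbracket_rcons -pE {1}/rb_bracket -P_pm !pm_mid.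
  rewrite -(rb_nbracket_pchar br_lts commP) // /rb_bracket.
  by rewrite pE (rb_nbracket commP).
split.
  split=> //.
  - split.
    + split=> [y z|x z|x y] a u v; rewrite /tp ?linearP.
      * by rewrite (br1D br_lin) (br1Z br_lin).
      * by rewrite (br2D br_lin) (br2Z br_lin).
      * by rewrite (br3D br_lin) (br3Z br_lin).
    (* Both axioms are instances of [deriv]: here for the pair x5, [P x1], in the next one for
       [P x1], [P x2]. *)
    + move=> x1 x2 x3 x4 x5; rewrite wedgeE commE /tp commP deriv.
      by rewrite (lts_antisym br_lts (P x2)).
    + by move=> x1 x2 x3 x4 x5; rewrite !wedgeE commE /tp deriv !commP.
  - move=> x y z; rewrite /tp /= -P_pm pm_mid pE nbracket_iter.
    by rewrite -pE.
  - by move=> x y z; rewrite /tp -P_pm pm_last pE nbracket_iter -pE.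
split=> //.
- split=> //; rewrite commE; apply: rb_bracket_lts => // a x y.
  by rewrite linearP.
- by move=> x y z; rewrite commE commP.
Qed.
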